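(* (Double Fermat's theorem) Suppose that $f$ is a double function which is defined on a double open interval $I$ and let $a\in I$. If $a$ is a double extreme point for $f$ on $I$, then $a$ is a double critical point for $f$.
   Context: Points of $\mathbb{R}^2$ are written $a=(a_1,a_2)$; $a\nsim b$ means $a_1\ne b_1$ and $a_2\ne b_2$. A double function is a real-valued function $f$ with domain $D(f)\subseteq\mathbb{R}^2$. A double open interval is a set $I=I_1\times I_2$ with $I_1,I_2$ open intervals in $\mathbb{R}$. The double difference is $\Delta_a^b(f)=f(b_1,b_2)-f(b_1,a_2)-f(a_1,b_2)+f(a_1,a_2)$. A point $a\in I$ is a double maximum point (double minimum point) for $f$ on $I$ if $\Delta_a^b(f)<0$ ($\Delta_a^b(f)>0$) for all $b\in I$ with $b\nsim a$. It is a double extreme point for $f$ on $I$ if it is a double maximum point or a double minimum point for $f$ on $I$. For $a\nsim x$ put $m_a^x(f)=\Delta_a^x(f)/((x_1-a_1)(x_2-a_2))$. $f$ is double differentiable at $a$ if $D(f)$ contains a double open interval containing $a$ and there is a real number $f'(a)$ (the double derivative) such that for every $\epsilon>0$ there are $\delta_1,\delta_2>0$ such that for all $x$ with $0<|x_1-a_1|<\delta_1$ and $0<|x_2-a_2|<\delta_2$, $m_a^x(f)$ is defined and $|m_a^x(f)-f'(a)|<\epsilon$. $a$ is a double stationary point for $f$ if $f$ is double differentiable at $a$ and $f'(a)=0$. $a$ is a double critical point for $f$ if either $f$ is not double differentiable at $a$ or $a$ is a double stationary point for $f$. *)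

(* Defs.v *)
From HB Require Import structures.
From mathcomp Require Import all_boot all_order all_algebra.
From mathcomp Require Import all_classical all_reals.
From mathcomp Require Import lra.
Set Implicit Arguments.
Unset Strict Implicit.
Unset Printing Implicit Defensive.
Import Order.TTheory GRing.Theory Num.Theory.
Local Open Scope classical_set_scope.
Local Open Scope ring_scope.

(* The values of [dval] outside [ddom] are junk: a notion below that evaluates
   [dval] is meaningful only when the points it reads lie in [ddom]. *)
Record double_function (R : realType) := DoubleFunction {
  ddom : set (R * R);
  dval :> R * R -> R
}.

Section DoubleCalculus.
Variable R : realType.
Implicit Types (f : double_function R) (I : set (R * R)) (a b x : R * R).

(* a ≁ b *)
Definition nsim a b : Prop := a.1 <> b.1 /\ a.2 <> b.2.

(* The sides may be bounded, half-lines, or the whole line. *)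
Definition double_open_interval I : Prop :=
  exists I1 I2 : interval R,
    [/\ itv_open_ends I1, itv_open_ends I2 & I = [set` I1] `*` [set` I2]].

Definition double_diff f a b : R :=
  f (b.1, b.2) - f (b.1, a.2) - f (a.1, b.2) + f (a.1, a.2).

Definition double_maximum_point f I a : Prop :=
  I a /\ forall b, I b -> nsim b a -> double_diff f a b < 0.

Definition double_minimum_point f I a : Prop :=
  I a /\ forall b, I b -> nsim b a -> 0 < double_diff f a b.

Definition double_extreme_point f I a : Prop :=
  double_maximum_point f I a \/ double_minimum_point f I a.

Definition double_quotient f a x : R :=
  double_diff f a x / ((x.1 - a.1) * (x.2 - a.2)).

Definition double_quotient_defined f a x : Prop :=
  nsim a x /\
  [/\ ddom f (x.1, x.2), ddom f (x.1, a.2), ddom f (a.1, x.2)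
    & ddom f (a.1, a.2)].

Definition is_double_derivative f a (l : R) : Prop :=
  forall e : R, 0 < e -> exists d1 d2 : R, [/\ 0 < d1, 0 < d2 &
    forall x, 0 < `|x.1 - a.1| < d1 -> 0 < `|x.2 - a.2| < d2 ->
      double_quotient_defined f a x /\ `|double_quotient f a x - l| < e].

Definition double_differentiable f a : Prop :=
  (exists J, [/\ double_open_interval J, J a & J `<=` ddom f]) /\
  (exists l, is_double_derivative f a l).

(* f'(a), with junk value 0 when no double derivative exists. *)
Definition double_derivative f a : R := xget 0 (is_double_derivative f a).

Definition double_stationary_point f a : Prop :=
  double_differentiable f a /\ double_derivative f a = 0.

Definition double_critical_point f a : Prop :=
  ~ double_differentiable f a \/ double_stationary_point f a.

Lemma is_double_derivative_unique f a l m :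
  is_double_derivative f a l -> is_double_derivative f a m -> l = m.
Proof.
move=> hl hm; apply/eqP; apply: contraT => lm.
have e0 : 0 < `|l - m| / 2 by rewrite divr_gt0// normr_gt0 subr_eq0.
have [d1 [d2 [d10 d20 hd]]] := hl _ e0.
have [c1 [c2 [c10 c20 hc]]] := hm _ e0.
have pick (u v : R) : 0 < u -> 0 < v ->
    exists t : R, [/\ 0 < t, t < u & t < v].
  move=> u0 v0; exists (Num.min u v / 2).
  have : 0 < Num.min u v by rewrite lt_min u0.
  have : Num.min u v <= u by rewrite ge_min lexx.
  have : Num.min u v <= v by rewrite ge_min lexx orbT.
  by move: (Num.min u v) => w *; split; lra.
have [t1 [t10 td1 tc1]] := pick _ _ d10 c10.
have [t2 [t20 td2 tc2]] := pick _ _ d20 c20.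
pose x := (a.1 + t1, a.2 + t2).
have n1 : `|x.1 - a.1| = t1 by rewrite /x/= addrC addKr gtr0_norm.
have n2 : `|x.2 - a.2| = t2 by rewrite /x/= addrC addKr gtr0_norm.
have [|| _ ql] := hd x; rewrite ?n1 ?n2 ?t10 ?t20//.
have [|| _ qm] := hc x; rewrite ?n1 ?n2 ?t10 ?t20//.
have := ler_distD (double_quotient f a x) l m.
by rewrite (distrC l (double_quotient f a x)); lra.
Qed.

Lemma double_derivativeE f a l :
  is_double_derivative f a l -> double_derivative f a = l.
Proof.
move=> hl; apply: xget_unique => // m hm.
exact: is_double_derivative_unique hm hl.
Qed.

End DoubleCalculus.

(* Main.v *)
(** The double derivative at [a] is a limit of [m_a^x(f)] along [x = a + (t, t)]
    and along [x = a + (t, -t)]. At a double extreme point the double difference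
    has one sign at all such [x], whereas [(x.1 - a.1) * (x.2 - a.2)] changes sign
    between the two diagonals, so the limit is both [>= 0] and [<= 0]. *)
Require Import Defs.
From mathcomp Require Import all_boot all_order all_algebra.
From mathcomp Require Import all_classical all_reals.
From mathcomp Require Import ring lra.
Import Order.TTheory GRing.Theory Num.Theory.
Local Open Scope classical_set_scope.
Local Open Scope ring_scope.

Lemma itv_open_ends_ball (R : realType) (J : interval R) (a : R) :
  itv_open_ends J -> a \in J ->
  exists2 r : R, 0 < r & forall t, `|t| < r -> a + t \in J.
Proof.
(* Four shapes survive: bounded, right half-line, left half-line, whole line. In the last the radius
   [1] is arbitrary. *)
case: J => [[[] l|[]] [[] u|[]]] //= _; rewrite !in_itv/= ?andbT.
- move=> /andP[la au]; exists (Num.min (a - l) (u - a)).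
    by rewrite lt_min !subr_gt0 la.
  by move=> t; rewrite lt_min !ltr_norml in_itv/= => *; apply/andP; split; lra.
- move=> la; exists (a - l); first by rewrite subr_gt0.
  by move=> t; rewrite ltr_norml in_itv/= andbT; lra.
- move=> au; exists (u - a); first by rewrite subr_gt0.
  by move=> t; rewrite ltr_norml in_itv/=; lra.
- by exists 1 => // t _; rewrite in_itv.
Qed.

Lemma double_open_interval_box (R : realType) (I : set (R * R)) (a : R * R) :
  double_open_interval I -> I a ->
  exists2 r : R, 0 < r &
    forall s t, `|s| < r -> `|t| < r -> I (a.1 + s, a.2 + t).
Proof.
move=> [I1 [I2 [o1 o2 ->]]] [/= a1 a2].
have [r1 r10 h1] := itv_open_ends_ball _ _ _ o1 a1.
have [r2 r20 h2] := itv_open_ends_ball _ _ _ o2 a2.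
exists (Num.min r1 r2); first by rewrite lt_min r10.
by move=> s t; rewrite !lt_min => /andP[s1 _] /andP[_ t2]; split;
  [exact: h1|exact: h2].
Qed.

(** A single radius below the box size and both thresholds serves all four sign choices of [(s, t)],
    so corners on the two diagonals can be compared. *)
Lemma is_double_derivative_corners (R : realType) (f : double_function R)
    (I : set (R * R)) (a : R * R) (l e : R) :
  double_open_interval I -> I a -> is_double_derivative f a l -> 0 < e ->
  exists2 r : R, 0 < r & forall s t, `|s| = r -> `|t| = r ->
    I (a.1 + s, a.2 + t) /\
    `|double_diff f a (a.1 + s, a.2 + t) / (s * t) - l| < e.
Proof.
move=> hI ha hl e0.
have [r r0 hr] := double_open_interval_box _ _ _ hI ha.
have [d1 [d2 [d10 d20 hd]]] := hl _ e0.
pose m := Num.min r (Num.min d1 d2).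
have m0 : 0 < m by rewrite !lt_min r0 d10.
have : m / 2 < m by lra.
rewrite {2}/m !lt_min => /and3P[mr m1 m2].
exists (m / 2) => [|s t sm tm]; first by lra.
split; first by apply: hr; rewrite ?sm ?tm.
have := hd (a.1 + s, a.2 + t).
rewrite /double_quotient/= !(addrC _ s) !(addrC _ t) !addrK sm tm.
by rewrite divr_gt0// m1 m2 => /(_ isT isT)[].
Qed.

(** The factor [c] treats both kinds of extreme point at once: [-1] for a maximum, [1] for a
    minimum. *)
Lemma double_derivative_eq0 (R : realType) (f : double_function R)
    (I : set (R * R)) (a : R * R) (l c : R) :
  double_open_interval I -> I a -> is_double_derivative f a l ->
  (forall b, I b -> nsim b a -> 0 < c * double_diff f a b) -> l = 0.
Proof.
move=> hI ha hl hc; apply/eqP; apply: contraT => l0.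
(* With tolerance [|l|], every quotient at a corner is nonzero and has the sign of [l]. *)
have e0 : 0 < `|l| by rewrite normr_gt0.
have [t t0 ht] := is_double_derivative_corners _ _ _ _ _ _ hI ha hl e0.
have nt : `|t| = t by rewrite gtr0_norm.
have nNt : `|- t| = t by rewrite normrN.
have pos s u : `|s| = t -> `|u| = t -> 0 < c * l * (s * u).
  move=> st ut; have [Ib] := ht _ _ st ut.
  have s0 : s != 0 by rewrite -normr_gt0 st.
  have u0 : u != 0 by rewrite -normr_gt0 ut.
  have /(hc _ Ib) : nsim (a.1 + s, a.2 + u) a.
    by split=> /= /eqP; rewrite -subr_eq0 addrC addKr; exact/negP.
  set q := _ / (s * u).
  have -> : double_diff f a (a.1 + s, a.2 + u) = q * (s * u).
    by rewrite divfK// mulf_neq0.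
  rewrite ltr_distl => cq ql.
  have lq : 0 < l * q.
    move: ql; case: (ltrgt0P l) l0 => // l_sign _ /andP[q1 q2].
      by rewrite mulr_gt0//; lra.
    by rewrite nmulr_rgt0//; lra.
  (* Multiplying by [l * q] turns the corner-dependent [q] into a positive square, which cancels. *)
  have : 0 < (c * (q * (s * u))) * (l * q) by rewrite mulr_gt0.
  have -> : (c * (q * (s * u))) * (l * q) = c * l * (s * u) * q ^+ 2 by ring.
  rewrite pmulr_lgt0// exprn_even_gt0//=.
  by apply: contraTneq lq => ->; rewrite mulr0 ltxx.
(* The corners [(t, t)] and [(t, -t)] would make both [c * l * t ^+ 2] and its opposite positive. *)
by have := pos _ _ nt nt; have := pos _ _ nt nNt; lra.
Qed.

Theorem proposition25 (R : realType) (f : double_function R)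
    (I : set (R * R)) (hI : double_open_interval I) (hf : I `<=` ddom f)
    (a : R * R) (ha : I a) :
  double_extreme_point f I a -> double_critical_point f a.
Proof.
move=> ext; have [fa|] := pselect (double_differentiable f a); last by left.
(* Uniqueness identifies the chosen value with the actual limit [l], so the [0] reached below is not
   the default of [xget]. *)
right; split=> //; have [_ [l hl]] := fa; rewrite (double_derivativeE hl).
case: ext => -[_ hext].
  apply: (double_derivative_eq0 _ _ _ _ _ (-1) hI ha hl) => b Ib ba.
  by rewrite mulN1r oppr_gt0 hext.
apply: (double_derivative_eq0 _ _ _ _ _ 1 hI ha hl) => b Ib ba.
by rewrite mul1r hext.
Qed.
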